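(* Let $M_1, \ldots, M_d \in \mathbb{C}^{n\times n}$ satisfy $\sum_{i=1}^d \operatorname{col} M_i = \sum_{i=1}^d \operatorname{row} M_i = \mathbb{C}^n$. Let $q$ be the largest rank of any element of $\operatorname{span}(M_1,\dots,M_d)$, and let $c_1,\dots,c_d$ and $r_1,\dots,r_d$ be the column and row profiles of the tuple $(M_1,\dots,M_d)$. Suppose that $q < n$, that $r_1, \ldots, r_d$ and $c_1, \ldots, c_d$ are non-increasing, and that $r_1 = c_1 = q$. Then $$\dim G_{M_1, \ldots, M_d} \leq \sum_{i=1}^d r_i c_i - r_2(q-r_2).$$
   Context: For a matrix $M \in \mathbb{C}^{n\times n}$, $\operatorname{col} M \subseteq \mathbb{C}^n$ is its column space and $\operatorname{row} M \subseteq \mathbb{C}^n$ its row space. For a tuple $(M_1,\dots,M_d)$ of $n\times n$ complex matrices, the stabilizer under left-right action is $$G_{M_1, \ldots, M_d} = \{(P,Q) \in \mathrm{GL}_n(\mathbb{C}) \times \mathrm{GL}_n(\mathbb{C}) : P M_i Q^T = M_i \text{ for all } i\in\{1,\dots,d\}\},$$ and $\dim$ denotes its dimension as an algebraic group. The column profile is $c_k = \operatorname{rank}(M_1 \mid M_2 \mid \cdots \mid M_k) - \operatorname{rank}(M_1 \mid \cdots \mid M_{k-1})$ for $k = 1,\dots,d$, where $(M_1\mid\cdots\mid M_k)$ is the $n\times nk$ matrix obtained by horizontal concatenation (the empty concatenation has rank $0$). The row profile $r_k$ is defined in the same way using vertical concatenation. Equivalently, $c_k = \dim \sum_{i\le k}\operatorname{col}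 M_i - \dim\sum_{i\le k-1}\operatorname{col} M_i$ and $r_k = \dim \sum_{i\le k}\operatorname{row} M_i - \dim\sum_{i\le k-1}\operatorname{row} M_i$. *)

(* Defs.v *)
From mathcomp Require Import all_boot all_order all_algebra.
From mathcomp Require Import complex.
From mathcomp Require Import boolp classical_sets reals constructive_ereal ereal.
From mathcomp Require mpoly.

Set Implicit Arguments.
Unset Strict Implicit.
Unset Printing Implicit Defensive.

Import Order.TTheory GRing.Theory Num.Theory.
Local Open Scope ring_scope.
Local Open Scope classical_set_scope.

Section ZariskiDimension.
Variables (K : fieldType) (N : nat).
Implicit Types (X Z F : set 'rV[K]_N).

Definition zariski_closed F : Prop :=
  exists S : set (mpoly.mpoly N K),
    F = [set x : 'rV[K]_N | forall p, S p -> mpoly.meval (x 0) p = 0].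

Definition closed_in X Z : Prop :=
  exists2 F, zariski_closed F & Z = X `&` F.

Definition zariski_irreducible Z : Prop :=
  Z !=set0 /\
  forall F1 F2, zariski_closed F1 -> zariski_closed F2 ->
    Z `<=` F1 `|` F2 -> Z `<=` F1 \/ Z `<=` F2.

(* C 0, ..., C k is a chain of length k, i.e. with k strict inclusions. *)
Definition irreducible_chain X (k : nat) (C : nat -> set 'rV[K]_N) : Prop :=
  (forall i, (i <= k)%N -> closed_in X (C i) /\ zariski_irreducible (C i)) /\
  (forall i, (i < k)%N -> C i `<` C i.+1).

(* The dimension of X as a topological space, for the topology induced by the
   Zariski topology of K^N; the dimension of the empty set is -oo. *)
Definition zariski_dim (R : realType) X : \bar R :=
  ereal_sup [set (k%:R : R)%:E | k in
    [set k : nat | exists C : nat -> set 'rV[K]_N, irreducible_chain X k C]].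

End ZariskiDimension.

Section Stabilizer.
Variables (K : fieldType) (n d : nat) (M : d.-tuple 'M[K]_n).

(* GL_n x GL_n carries the topology induced by K^(n^2 + n^2), in which it is a
   principal open subset; hence its closed subgroup below is given by its
   points in that affine space. *)
Definition stabilizer : set 'rV[K]_(n * n + n * n) :=
  [set row_mx (mxvec PQ.1) (mxvec PQ.2) | PQ in
    [set PQ : 'M[K]_n * 'M[K]_n |
      [/\ PQ.1 \in unitmx, PQ.2 \in unitmx
        & forall i : 'I_d, PQ.1 *m tnth M i *m PQ.2^T = tnth M i]]].

(* Ranks of (M_1 | ... | M_k) and of its vertical analogue, for k <= d. *)
Definition col_rank (k : nat) : nat := \rank (\mxrow_(i < k) M`_i).
Definition row_rank (k : nat) : nat := \rank (\mxcol_(i < k) M`_i).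

(* Profiles are indexed by 1 <= k <= d.  The truncated subtraction is exact,
   since the ranks are nondecreasing in k. *)
Definition col_profile (k : nat) : nat := (col_rank k - col_rank k.-1)%N.
Definition row_profile (k : nat) : nat := (row_rank k - row_rank k.-1)%N.

Definition is_max_rank_span (q : nat) : Prop :=
  (exists2 A, A \in <<M>>%VS & \rank A = q) /\
  (forall A, A \in <<M>>%VS -> (\rank A <= q)%N).

End Stabilizer.

Definition nonincreasing_profile (d : nat) (r : nat -> nat) : Prop :=
  forall i j, (1 <= i)%N -> (i <= j)%N -> (j <= d)%N -> (r j <= r i)%N.

(* Main.v *)
(* Substituting S = Q^-T, the stabilizer becomes the set of invertible elements
   of the linear space A of pairs (X, Y) with X M_i = M_i Y for all i, so its
   dimension is at most the linear dimension of A.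

   A chain of length k of irreducible closed subsets of the stabilizer gives
   polynomials p_0, ..., p_(k-1), where p_i vanishes on the i-th set of the chain
   but not on the next one; these are algebraically independent on the last set.
   Along the parametrization by A, and after clearing a power of det S, the D^k
   monomials in the p_i with exponents below D become polynomials of degree
   O(D) in dim A variables, and letting D grow yields k <= dim A.

   Filter A by the subspaces A_k of pairs with X M_i = 0 (= M_i Y) for i <= k.
   For (X, Y) in A_(k-1), the matrix X M_k = M_k Y kills a subspace of
   codimension c_k and has its image in a space of dimension r_k, so that
   dim A_(k-1) <= dim A_k + r_k c_k.  In the first step something is gained: as
   no M_1 + t M_2 has rank larger than that of M_1, the image W of ker M_1 under
   M_2 lies in col M_1; X stabilizes W, of dimension r_2, inside col M_1, of
   dimension q, and such endomorphisms of col M_1 form a space of codimension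
   r_2 (q - r_2). *)

Require Import Defs.
From mathcomp Require Import all_boot all_order all_algebra.
From mathcomp Require Import complex zify.
From mathcomp Require Import boolp classical_sets reals constructive_ereal ereal.
From mathcomp Require mpoly.

Set Implicit Arguments.
Unset Strict Implicit.
Unset Printing Implicit Defensive.

Import Order.TTheory GRing.Theory Num.Theory.
(* The notations of mpoly clash with those of mathcomp-analysis. *)
Import -(notations) mpoly.
Local Open Scope ring_scope.

(** * Chains of irreducible closed sets *)

Local Notation msize p := (mmeasure mdeg p).

Section Vanishing.
Variables (K : fieldType) (N : nat).
Implicit Types (p q : mpoly N K) (Z : set 'rV[K]_N).

Definition vanish Z p : Prop := forall z, Z z -> meval (z 0) p = 0.

Lemma irreducible_vanishM Z p q :
  zariski_irreducible Z -> vanish Z (p * q) -> vanish Z p \/ vanish Z q.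
Proof.
move=> [_ irrZ] vpq.
have zeros_closed f : zariski_closed [set x : 'rV[K]_N | meval (x 0) f = 0]%classic.
  exists [set f]%classic; apply/seteqP; split=> x /=; first by move=> h _ ->.
  by apply.
case: (irrZ _ _ (zeros_closed p) (zeros_closed q)); last 2 first.
- by left.
- by right.
by move=> z /vpq /=; rewrite mevalM => /eqP; rewrite mulf_eq0 => /orP[]/eqP; [left|right].
Qed.

Lemma irreducible_vanishX Z p k :
  zariski_irreducible Z -> ~ vanish Z p -> ~ vanish Z (p ^+ k).
Proof.
move=> irrZ np; elim: k => [|k IHk].
  case: irrZ => -[z Zz] _ /(_ z Zz); rewrite expr0 meval1 => /eqP.
  by rewrite oner_eq0.
by rewrite exprS => /(irreducible_vanishM irrZ)[].
Qed.

Lemma irreducible_chain_vanish X k C : irreducible_chain X k C ->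
  exists p : nat -> mpoly N K,
    forall i, (i < k)%N -> vanish (C i) (p i) /\ ~ vanish (C i.+1) (p i).
Proof.
case=> closedC ltC.
suff sep i : exists p, (i < k)%N -> vanish (C i) p /\ ~ vanish (C i.+1) p.
  by have [p pP] := choice sep; exists p.
have [ik|] := ltnP i k; last by exists 0.
have [[F [S defF] defC] _] := closedC i (ltnW ik).
have [[F' _ defC'] _] := closedC i.+1 ik.
have [sub ne] := ltC i ik.
have /existsNP[z /not_implyP[Cz nCz]] := ne.
have nFz : ~ F z by move=> Fz; apply: nCz; rewrite defC; split=> //;
  move: Cz; rewrite defC' => -[].
have /existsNP[p /not_implyP[Sp pz]] : ~ forall p, S p -> meval (z 0) p = 0.
  by move=> h; apply: nFz; rewrite defF.
exists p => _; split=> [y|vp]; last exact/pz/vp.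
by rewrite defC defF => -[_]; apply.
Qed.

End Vanishing.

(** A nested product rather than a function type, so that the exponent of the last polynomial splits
    off in inductions on [k]. *)
Fixpoint exponents (D k : nat) : finType :=
  if k is k'.+1 then ('I_D * exponents D k')%type else unit.

Lemma card_exponents D k : #|exponents D k| = (D ^ k)%N.
Proof. by elim: k => [|k IHk] /=; rewrite ?card_unit // card_prod card_ord IHk expnS. Qed.

Fixpoint monomial (A : nzRingType) (p : nat -> A) (D k : nat) : exponents D k -> A :=
  if k is k'.+1 then fun e => p k' ^+ e.1 * monomial p e.2 else fun=> 1.

(* In a relation of lowest degree j in the last polynomial p, irreducibility
   allows one to cancel p ^ j; restricting to the previous set of the chain,
   where p vanishes, leaves a relation between the other polynomials. *)
Lemma chain_monomials_free (K : fieldType) N k C (p : nat -> mpoly N K) D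
    (c : exponents D k -> K) :
    (forall i, (i <= k)%N -> zariski_irreducible (C i)) ->
    (forall i, (i < k)%N -> (C i `<=` C i.+1)%classic) ->
    (forall i, (i < k)%N -> vanish (C i) (p i) /\ ~ vanish (C i.+1) (p i)) ->
    vanish (C k) (\sum_e c e *: monomial p e) ->
  forall e, c e = 0.
Proof.
move=> irrC; elim: k irrC c => [|k IHk] irrC c subC pC vc.
  case; have [[z Cz] _] := irrC 0 isT.
  have := vc z Cz; rewrite (big_pred1 tt) /=; last by case.
  by rewrite mevalZ meval1 mulr1.
have [pk npk] := pC k (ltnSn k).
pose S (j : 'I_D) := \sum_e c (j, e) *: monomial p e.
have vS : vanish (C k.+1) (\sum_(j < D) p k ^+ j * S j).
  move: vc; congr (vanish _ _); rewrite (eq_bigr (fun e : 'I_D * exponents D k =>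
    p k ^+ e.1 * (c (e.1, e.2) *: monomial p e.2))); last first.
    by move=> -[i e] _ /=; rewrite scalerAr.
  rewrite -(pair_bigA _ (fun (i : 'I_D) e => p k ^+ i * (c (i, e) *: monomial p e))) /=.
  by apply: eq_bigr => i _; rewrite -mulr_sumr.
suff cS m (j : 'I_D) : (j < m)%N -> forall e, c (j, e) = 0.
  by move=> -[j e]; apply: (cS D).
elim: m j => // m IHm j; rewrite ltnS leq_eqVlt => /predU1P[jm|/IHm //].
apply: IHk => [i ik|i ik|i ik|].
- by apply: irrC; rewrite leqW.
- by apply: subC; rewrite leqW.
- by apply: pC; rewrite leqW.
(* The terms of index below [j] vanish by [IHm], and those above contain the factor
   [p k ^+ j.+1]. *)
pose T := \sum_(i < D | (j < i)%N) p k ^+ (i - j.+1) * S i.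
have defS : \sum_(i < D) p k ^+ i * S i = p k ^+ j * (S j + p k * T).
  rewrite (bigD1 j) //= mulrDr; congr (_ + _).
  rewrite (bigID (fun i : 'I_D => (j < i)%N)) /= [X in _ + X]big1 ?addr0; last first.
    move=> i /andP[ij ji]; rewrite [S i]big1 ?mulr0 // => e _.
    by rewrite IHm ?scale0r //; move: ij; rewrite -val_eqE /=; lia.
  rewrite /T !mulr_sumr; apply: eq_big => [i|i /andP[_ ji]].
    by rewrite -val_eqE /=; lia.
  by rewrite !mulrA -exprSr -exprD; congr (_ ^+ _ * _); lia.
move: vS; rewrite defS => /(irreducible_vanishM (irrC _ (leqnn _))).
case=> [/(irreducible_vanishX (irrC _ (leqnn _)) npk) //|vST] z Cz.
have := vST z (subC k (ltnSn k) z Cz).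
by rewrite mevalD mevalM pk // mul0r addr0.
Qed.

(** * Degree bounds and linear dependence of polynomials *)

Lemma msizeM_leq n (K : fieldType) (p q : mpoly n K) a b :
  (msize p <= a.+1 -> msize q <= b.+1 -> msize (p * q) <= (a + b).+1)%N.
Proof.
have [->|p0] := eqVneq p 0; first by rewrite mul0r msize0.
have [->|q0] := eqVneq q 0; first by rewrite mulr0 msize0.
move=> pa qb; rewrite msizeM // -ltnS prednK ?addn_gt0 ?lt0n ?msize_poly_eq0 ?p0 //.
by rewrite -addnS -addSn leq_add.
Qed.

Lemma msizeX_leq n (K : fieldType) (p : mpoly n K) a k :
  (msize p <= a.+1 -> msize (p ^+ k) <= (a * k).+1)%N.
Proof.
move=> pa; elim: k => [|k IHk]; first by rewrite expr0 msize1.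
by rewrite exprS mulnS msizeM_leq.
Qed.

(** In a multinomial of degree below [b] every exponent is below [b]; this crude count has the right
    order of growth in [b]. *)
Lemma card_bmultinom n b : (#|{: bmultinom n b}| <= b ^ n)%N.
Proof.
have bound (m : bmultinom n b) i : (bmnm m i < b)%N.
  by apply: leq_ltn_trans (bmdeg m); rewrite mdegE (bigD1 i) //= leq_addr.
rewrite -[X in (_ <= _ ^ X)%N]card_ord -[X in (_ <= X ^ _)%N]card_ord -card_ffun.
apply: (@leq_card _ _ (fun m : bmultinom n b => [ffun i => Ordinal (bound m i)])).
move=> m1 m2 /ffunP eq12; apply/val_inj/mnmP => i.
by have := eq12 i; rewrite !ffunE => -[].
Qed.

Lemma mpoly_family_dependent (K : fieldType) n b (I : finType) (P : I -> mpoly n K) :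
    (forall i, (msize (P i) <= b)%N) -> (b ^ n < #|I|)%N ->
  exists2 c : I -> K, \sum_i c i *: P i = 0 & exists i, c i != 0.
Proof.
move=> Pb ltI.
pose A := \matrix_(i < #|I|, m < #|{: bmultinom n b}|)
  mcoeff (bmnm (enum_val m)) (P (enum_val i)).
have : kermx A != 0.
  rewrite kermx_eq0 -row_leq_rank -ltnNge.
  by rewrite (leq_ltn_trans (rank_leq_col _)) // (leq_ltn_trans (card_bmultinom _ _)).
case/rowV0Pn => v /sub_kermxP vA /rV0Pn[j vj].
exists (fun i => v 0 (enum_rank i)); last by exists (enum_val j); rewrite enum_valK.
under eq_bigr => i _ do rewrite (mpolywE (Pb i)) scaler_sumr.
rewrite exchange_big big1 //= => m _.
under eq_bigr => i _ do rewrite scalerA.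
rewrite -scaler_suml (_ : \sum_i _ = 0) ?scale0r //.
have /rowP/(_ (enum_rank m)) := vA; rewrite !mxE => sum0; rewrite -[RHS]sum0.
rewrite [RHS](reindex enum_rank) /=; last first.
  by apply: onW_bij; exists enum_val; [apply: enum_rankK|apply: enum_valK].
by apply: eq_bigr => i _; rewrite mxE !enum_rankK.
Qed.

(** * Dimension bound from a rational parametrization *)

Section Parametrization.
Variables (K : fieldType) (N m : nat).
Variables (delta : mpoly m K) (h : 'I_N -> mpoly m K).

(** The point [x] is the value at [t] of the rational map with numerators [h i] and common
    denominator [delta]. *)
Definition parametrizes (t : 'I_m -> K) (x : 'rV[K]_N) : Prop :=
  meval t delta != 0 /\ forall i, meval t (h i) = meval t delta * x 0 i.

Definition clears (p : mpoly N K) (e : nat) (P : mpoly m K) : Prop :=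
  forall t x, parametrizes t x -> meval t P = meval t delta ^+ e * meval (x 0) p.

Lemma clearsM p q e f P Q :
  clears p e P -> clears q f Q -> clears (p * q) (e + f) (P * Q).
Proof.
by move=> pP qQ t x tx; rewrite !mevalM (pP t x tx) (qQ t x tx) exprD mulrACA.
Qed.

Lemma clearsX p e P k : clears p e P -> clears (p ^+ k) (e * k) (P ^+ k).
Proof.
move=> pP; elim: k => [|k IHk]; last by rewrite !exprS mulnS; apply: clearsM.
by move=> t x _; rewrite muln0 !expr0 !meval1 mulr1.
Qed.

Lemma clears_delta e : clears 1 e (delta ^+ e).
Proof. by move=> t x _; rewrite meval1 mulr1 rmorphXn. Qed.

Lemma ex_clears p : exists e P, clears p e P.
Proof.
elim/mpolyind: p => [|c u p _ _ [e [P pP]]].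
  by exists 0%N, 0 => t x _; rewrite !meval0 mulr0.
have uP : clears (mpolyX K u) (mdeg u) (\prod_i h i ^+ u i).
  move=> t x [_ tx]; rewrite rmorph_prod mevalX mdegE -prodrXr -big_split /=.
  by apply: eq_bigr => i _; rewrite rmorphXn /= tx exprMn.
exists (mdeg u + e)%N, (c *: ((\prod_i h i ^+ u i) * delta ^+ e) + delta ^+ mdeg u * P).
move=> t x tx; rewrite !mevalD !mevalZ.
have := clearsM uP (clears_delta e) tx; rewrite mulr1 => ->.
have := clearsM (clears_delta (mdeg u)) pP tx; rewrite mul1r => ->.
by rewrite mulrDr mulrCA.
Qed.

(** The power [E] of [delta] is the same for all [e], so that it factors out of linear combinations:
    a factor [p k ^+ j] is topped up by [delta ^+ (f * (D - j))]. The slope [a] of the degree bound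
    does not depend on [D]. *)
Lemma clears_monomials (p : nat -> mpoly N K) k : exists a, forall D, exists E,
  forall e : exponents D k,
    exists2 P, (msize P <= (a * D).+1)%N & clears (monomial p e) E P.
Proof.
elim: k => [|k [a IHk]].
  exists 0%N => D; exists 0%N => e; exists 1; first by rewrite msize1.
  by move=> t x _; rewrite !meval1 mul1r.
have [f [Q pQ]] := ex_clears (p k).
exists (msize Q + msize delta * f + a)%N => D; have [E IHD] := IHk D.
exists (f * D + E)%N => -[j e]; have [P sP eP] := IHD e.
exists (Q ^+ j * delta ^+ (f * (D - j)) * P); last first.
  have -> : (f * D = f * j + f * (D - j))%N.
    by rewrite -mulnDr subnKC // ltnW.
  apply: clearsM eP => /=; rewrite -[X in clears X]mulr1.
  by apply: clearsM; [apply: clearsX|apply: clears_delta].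
have jD := ltn_ord j.
have -> : ((msize Q + msize delta * f + a) * D =
  msize Q * D + msize delta * (f * D) + a * D)%N by rewrite !mulnDl mulnA.
apply: msizeM_leq sP.
apply: leq_trans (msizeM_leq (msizeX_leq _ (leqnSn _)) (msizeX_leq _ (leqnSn _))) _.
rewrite ltnS leq_add // leq_mul2l ?(ltnW jD) ?orbT // leq_mul2l leq_subr !orbT //.
Qed.

Lemma irreducible_chain_le (X : set 'rV[K]_N) k C :
    (forall x, X x -> exists t, parametrizes t x) ->
  irreducible_chain X k C -> (k <= m)%N.
Proof.
move=> Xpar chainC; have [p pC] := irreducible_chain_vanish chainC.
have [closedC ltC] := chainC; have [a aP] := clears_monomials p k.
(* Otherwise the cleared monomials are linearly dependent; dividing the relation by [delta ^+ E]
   gives one between the monomials on the last set of the chain. *)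
have bound D : (D ^ k <= (a * D).+1 ^ m)%N.
  rewrite leqNgt -(card_exponents D); apply/negP => lt_card.
  have [E /(_ _)/cid2-/all_sig2[P sP eP]] := aP D.
  have [c c0 [e /negP]] := mpoly_family_dependent sP lt_card; apply; apply/eqP.
  move: e; apply: (chain_monomials_free (C := C) (p := p)) => //.
  - by move=> i /closedC[].
  - by move=> i /ltC[].
  move=> x Cx; have [|t tx] := Xpar x.
    by have [[F _ defC] _] := closedC k (leqnn k); move: Cx; rewrite defC => -[].
  have : meval t (\sum_e c e *: P e) = 0 by rewrite c0 meval0.
  rewrite !rmorph_sum /=; under eq_bigr => e _ do rewrite mevalZ (eP e t x tx) mulrCA.
  rewrite -mulr_sumr => /eqP; rewrite mulf_eq0 expf_eq0 (negPf tx.1) andbF /=.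
  by move=> /eqP; under [in X in _ -> X]eq_bigr => e _ do rewrite mevalZ.
rewrite leqNgt; apply/negP => mk.
(* With this [D], [(a * D).+1 ^ m <= a.+1 ^ m * D ^ m < D ^ m.+1], which contradicts [bound] if
   [m < k]. *)
pose D := (a.+1 ^ m).+1.
have := leq_trans (leq_pexp2l (ltn0Sn _ : 0 < D)%N mk) (bound D).
rewrite expnS leqNgt => /negP; apply.
apply: (@leq_ltn_trans ((a.+1 * D) ^ m)).
  have [->|m0] := posnP m; first by rewrite !expn0.
  by rewrite leq_exp2r // mulSn addnC -addn1 leq_add2l.
by rewrite expnMn ltn_pmul2r ?expn_gt0.
Qed.

Lemma zariski_dim_le (R : realType) (X : set 'rV[K]_N) :
    (forall x, X x -> exists t, parametrizes t x) ->
  (zariski_dim R X <= (m%:R : R)%:E)%E.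
Proof.
move=> Xpar; apply: ge_ereal_sup => _ [k [C chainC] <-].
by rewrite lee_fin ler_nat (irreducible_chain_le Xpar chainC).
Qed.

End Parametrization.

(** * Spaces of matrices *)

(** Right multiplication by [cokermx N] has the row space of [N] as its kernel, so it computes ranks
    modulo that space. *)
Lemma mxrank_mul_coker (K : fieldType) m1 m2 n (N : 'M[K]_(m1, n))
    (B : 'M[K]_(m2, n)) :
  (\rank (B *m cokermx N) + \rank N)%N = \rank (N + B)%MS.
Proof.
have ker_coker : (kermx (cokermx N) :=: N)%MS.
  apply/eqmxP/andP; split; last by apply/sub_kermxP; rewrite mulmx_coker.
  by rewrite submxE mulmx_ker.
have := mxrank_mul_ker B (cokermx N); rewrite (cap_eqmx (eqmx_refl B) ker_coker).
have := mxrank_sum_cap N B; rewrite capmxC; lia.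
Qed.

Lemma polynomial_function_eq0 (K : numFieldType) (p : {poly K}) :
  (forall t, p.[t] = 0) -> p = 0.
Proof.
move=> p0; apply/eqP; apply: contraT => nz_p.
have := @max_poly_roots _ p [seq i%:R | i <- iota 0 (size p)] nz_p.
rewrite size_map size_iota ltnn => -> //.
  by apply/allP => x _; rewrite rootE p0.
by rewrite map_inj_uniq ?iota_uniq // => i j /eqP; rewrite eqr_nat => /eqP.
Qed.

Lemma full_rank_inverses (K : fieldType) m n (A : 'M[K]_(m, n)) :
  exists L R, L *m A *m R = 1%:M :> 'M_(\rank A).
Proof.
have /row_fullP[L L1] := col_base_full A.
have /row_freeP[R R1] := row_base_free A.
exists L, R; have <- := R1; rewrite -[in RHS](mul1mx (row_base A)) -L1.
by rewrite -(mulmxA L (col_base A)) mulmx_base.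
Qed.

(* The minor bordering an invertible one of A by a row of [kermx A] and a column
   of [cokermx A] vanishes at A + t B for all t; it is divisible by t, and at
   t = 0 its quotient by t is the corresponding entry of the product. *)
Lemma ker_coker_max_rank (K : numFieldType) m n (A B : 'M[K]_(m, n)) :
    (forall t, (\rank (A + t *: B)%R <= \rank A)%N) ->
  kermx A *m B *m cokermx A = 0.
Proof.
move=> maxA; have [L [R LAR]] := full_rank_inverses A.
apply/matrixP => i j; rewrite [RHS]mxE.
pose u := row i (kermx A); pose v := col j (cokermx A).
have uA : u *m A = 0 by rewrite -row_mul mulmx_ker row0.
have Av : A *m v = 0 by rewrite /v colE mulmxA mulmx_coker mul0mx.
transitivity ((u *m B *m v) 0 0).
  by rewrite /u /v colE mulmxA -colE -!row_mul !mxE.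
pose a := L *m B *m R; pose b := L *m B *m v; pose c := u *m B *m R.
pose s := u *m B *m v.
pose C := map_mx (@polyC K).
(* The bordered matrix of [A + 'X B], with its last column divided by ['X]; [u] and [v] annihilate
   [A], so the border contains only terms from [B]. *)
pose P := block_mx (1%:M + 'X *: C _ _ a) (C _ _ b) ('X *: C _ _ c) (C _ _ s).
have detP t : (\det P).[t] =
    \det (block_mx (1%:M + t *: a) b (t *: c) s).
  rewrite -horner_evalE -det_map_mx map_block_mx; congr (\det (block_mx _ _ _ _));
  by apply/matrixP => k l; rewrite !mxE /= /horner_eval !hornerE ?mulrb ?hornerE //;
   case: eqP; rewrite ?hornerE.
have P0 : 'X * \det P = 0.
  apply: polynomial_function_eq0 => t; rewrite hornerM hornerX detP mulrC.
  have detT : \det (block_mx (1%:M : 'M[K]_(\rank A)) 0 0 (t%:M : 'M_1)) = t.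
    by rewrite det_ublock det1 mul1r det_scalar1.
  rewrite -[X in _ * X]detT -det_mulmx mulmx_block !mulmx1 !mulmx0 !addr0 !add0r.
  rewrite !mul_mx_scalar.
  have -> : block_mx (1%:M + t *: a) (t *: b) (t *: c) (t *: s) =
      col_mx L u *m (A + t *: B) *m row_mx R v.
    rewrite mul_col_mx mul_col_row !mulmxDr !mulmxDl LAR.
    by rewrite -!scalemxAr -!scalemxAl uA !mul0mx -(mulmxA L A v) Av mulmx0 !add0r.
  set D := (X in \det X).
  have rD : (\rank D < \rank A + 1)%N.
    apply: (@leq_ltn_trans (\rank A)); last by rewrite addn1.
    apply: leq_trans (maxA t).
    by rewrite (leq_trans (mxrankM_maxl _ _)) ?mxrankM_maxr.
  apply/eqP; move: rD; rewrite ltnNge; apply: contraR => nz_D.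
  by rewrite row_leq_rank row_free_unit unitmxE unitfE.
have : (\det P).[0] = 0.
  by move/eqP: P0; rewrite mulf_eq0 polyX_eq0 /= => /eqP ->; rewrite horner0.
by rewrite detP !scale0r addr0 det_ublock det1 mul1r det_mx11.
Qed.

Lemma cokermx_tr (K : fieldType) m n (N : 'M[K]_(m, n)) :
  ((cokermx N)^T :=: kermx N^T)%MS.
Proof.
apply/eqmxP.
have sub : ((cokermx N)^T <= kermx N^T)%MS.
  by apply/sub_kermxP; rewrite -trmx_mul mulmx_coker trmx0.
by rewrite -(mxrank_leqif_eq sub) mxrank_tr mxrank_coker mxrank_ker mxrank_tr.
Qed.

(** The columns of [cokermx N] span the right kernel of [N]. *)
Lemma cokermx_factor (K : fieldType) m n p (N : 'M[K]_(m, n)) (Y : 'M[K]_(n, p)) :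
  N *m Y = 0 -> exists Y', Y = cokermx N *m Y'.
Proof.
move=> NY; have /submxP[D defD] : (Y^T <= (cokermx N)^T)%MS.
  by rewrite cokermx_tr; apply/sub_kermxP; rewrite -trmx_mul NY trmx0.
by exists D^T; apply: trmx_inj; rewrite trmx_mul trmxK.
Qed.

Lemma kermx_mul_eq0_factor (K : fieldType) m n p (A : 'M[K]_(m, n))
    (W : 'M[K]_(m, p)) :
  kermx A *m W = 0 -> exists U, W = A *m U.
Proof.
move=> kW; have /submxP[D defD] : (W^T <= A^T)%MS.
  rewrite submxE -[cokermx _]trmxK -trmx_mul.
  have := cokermx_tr A^T; rewrite trmxK => /eqmxP/andP[/submxP[E ->] _].
  by rewrite -mulmxA kW mulmx0 trmx0.
by exists D^T; apply: trmx_inj; rewrite trmx_mul trmxK.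
Qed.

Lemma dim_le_mulmx_image (K : fieldType) m n r s (L : 'M[K]_(m, r))
    (R : 'M[K]_(s, n)) (U : {vspace 'M[K]_(r, s)}) (V : {vspace 'M[K]_(m, n)}) :
    (forall Z, Z \in V -> exists2 z, z \in U & Z = L *m z *m R) ->
  (\dim V <= \dim U)%N.
Proof.
move=> VU; pose f : 'Hom('M[K]_(r, s), 'M[K]_(m, n)) := linfun (mulmxr R \o mulmx L).
apply: (@leq_trans (\dim (f @: U)%VS)); last first.
  by rewrite -(limg_ker_dim f U) leq_addl.
apply/dimvS/subvP => Z /VU[z zU ->].
by have -> : L *m z *m R = f z by [rewrite lfunE]; rewrite memv_img.
Qed.

Lemma dim_fullv_mx (K : fieldType) m n : \dim {:'M[K]_(m, n)} = (m * n)%N.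
Proof. by rewrite dimvf. Qed.

Lemma mulmx_regroup (K : fieldType) m n p q r s (A : 'M[K]_(m, n)) (B : 'M[K]_(n, p))
    (C : 'M[K]_(p, q)) (D : 'M[K]_(q, r)) (E : 'M[K]_(r, s)) :
  A *m (B *m C *m D) *m E = A *m B *m (C *m D *m E).
Proof. by rewrite !mulmxA. Qed.

Lemma row_base_proj (K : fieldType) m n (A : 'M[K]_(m, n)) R :
  row_base A *m R = 1%:M -> A *m R *m row_base A = A.
Proof.
move=> R1; transitivity (col_base A *m row_base A *m R *m row_base A).
  by rewrite mulmx_base.
by rewrite -(mulmxA _ _ R) R1 mulmx1 mulmx_base.
Qed.

Lemma col_base_proj (K : fieldType) m n (A : 'M[K]_(m, n)) L :
  L *m col_base A = 1%:M -> col_base A *m L *m A = A.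
Proof.
move=> L1; transitivity (col_base A *m L *m (col_base A *m row_base A)).
  by rewrite mulmx_base.
by rewrite mulmxA -(mulmxA _ L) L1 mulmx1 mulmx_base.
Qed.

(** Such a [Z] is determined by its coordinates in bases of the column space of [A] and of the row
    space of [B]. *)
Lemma dim_le_rank_mul (K : fieldType) m n p q (A : 'M[K]_(m, p)) (B : 'M[K]_(q, n))
    (V : {vspace 'M[K]_(m, n)}) :
    (forall Z, Z \in V -> (exists Y, Z = A *m Y) /\ (exists X, Z = X *m B)) ->
  (\dim V <= \rank A * \rank B)%N.
Proof.
move=> VAB; rewrite -(dim_fullv_mx K).
have /row_fullP[L L1] := col_base_full A; have /row_freeP[R R1] := row_base_free B.
apply: (@dim_le_mulmx_image _ _ _ _ _ (col_base A) (row_base B)) => Z.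
move=> /VAB[[Y ZY] [X ZX]]; exists (L *m Z *m R); first exact: memvf.
have ZR : Z *m R *m row_base B = Z by rewrite ZX -!mulmxA (mulmxA B) row_base_proj.
by rewrite mulmx_regroup ZR ZY mulmxA col_base_proj.
Qed.

(** One-sided inverses of [A] and [B] make the map surjective, and rank-nullity applies. *)
Lemma dim_lker_mulmx (K : fieldType) m n r s (A : 'M[K]_(r, m)) (B : 'M[K]_(n, s)) :
    row_free A -> row_full B ->
  (\dim (lker (linfun (mulmxr B \o mulmx A : 'M[K]_(m, n) -> 'M[K]_(r, s))))
     + r * s)%N = (m * n)%N.
Proof.
move=> /row_freeP[A' A1] /row_fullP[B' B1].
rewrite -!(dim_fullv_mx K); set f := linfun _.
have := limg_ker_dim f fullv; rewrite capfv => <-; congr (_ + \dim _)%N.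
apply/vspaceP => y; rewrite memvf; apply/esym/memv_imgP.
exists (A' *m y *m B'); first exact: memvf.
by rewrite lfunE /= !mulmxA A1 mul1mx -mulmxA B1 mulmx1.
Qed.

(* Writing Z = L z R with A = L R the full rank factorization, such z preserve
   the column space of the matrix w for which B * cokermx A = L w. *)
Lemma dim_le_parabolic (K : fieldType) n (A B : 'M[K]_n) (V : {vspace 'M[K]_n}) :
    kermx A *m B *m cokermx A = 0 ->
    (forall Z, Z \in V -> exists X Y,
       [/\ Z = X *m A, Z = A *m Y & X *m B = B *m Y]) ->
  let r := \rank (B *m cokermx A) in
  (r <= \rank A /\ \dim V + r * (\rank A - r) <= \rank A * \rank A)%N.
Proof.
rewrite -mulmxA; set W := B *m cokermx A => /kermx_mul_eq0_factor[U defW] inV r.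
have /row_fullP[L L1] := col_base_full A; have /row_freeP[R R1] := row_base_free A.
pose w := row_base A *m U.
have Ww : W = col_base A *m w by rewrite /w mulmxA mulmx_base.
have rw : \rank w = r by rewrite /r Ww (eqmxMfull _ (col_base_full A)).
have le_r : (r <= \rank A)%N by rewrite -rw rank_leq_row.
split=> //.
(* That [z] preserves the column space of [w] means that the left kernel of [w], of dimension
   [\rank A - r], annihilates [z *m col_base w]. *)
have <- := dim_lker_mulmx (row_base_free (kermx w)) (col_base_full w).
rewrite [X in (_ <= _ + X)%N](_ : _ = r * (\rank A - r))%N; last first.
  by rewrite mxrank_ker rw mulnC.
rewrite leq_add2r.
apply: (@dim_le_mulmx_image _ _ _ _ _ (col_base A) (row_base A)) => Z.
move=> /inV[X [Y [ZX ZY XB]]].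
have ZE : Z = col_base A *m (L *m Z *m R) *m row_base A.
  have ZR : Z *m R *m row_base A = Z by rewrite ZX -(mulmxA X) -(mulmxA X) row_base_proj.
  by rewrite mulmx_regroup ZR {2}ZY mulmxA col_base_proj.
exists (L *m Z *m R) => //; set z := L *m Z *m R in ZE *.
(* [Y] preserves the right kernel of [A], since [A *m Y = X *m A]. Hence
   [X *m W = B *m Y *m cokermx A = W *m Y'], and [zw] is this identity in coordinates. *)
have [Y' defY'] : exists Y', Y *m cokermx A = cokermx A *m Y'.
  by apply: cokermx_factor; rewrite mulmxA -ZY ZX -mulmxA mulmx_coker mulmx0.
have zw : z *m w = w *m Y'.
  suff eqL : col_base A *m (z *m w) = col_base A *m (w *m Y').
    by rewrite -[LHS]mul1mx -L1 -mulmxA eqL mulmxA L1 mul1mx.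
  rewrite (mulmxA (col_base A) w) -Ww (mulmxA (col_base A) z) (mulmxA _ _ U) -ZE.
  by rewrite ZX -mulmxA -defW /W -mulmxA -defY' !mulmxA XB.
rewrite memv_ker lfunE /=; apply/eqP.
have /row_freeP[T T1] := row_base_free w.
transitivity (row_base (kermx w) *m (z *m (col_base w *m row_base w)) *m T).
  rewrite (mulmxA z) (mulmxA _ _ (row_base w)) -(mulmxA _ (row_base w)) T1 mulmx1.
  by rewrite mulmxA.
have /submxP[D ->] : (row_base (kermx w) <= kermx w)%MS by rewrite eq_row_base.
by rewrite mulmx_base zw (mulmxA _ w) -(mulmxA D) mulmx_ker mulmx0 !mul0mx.
Qed.

(** * The space of intertwiners *)

Section Intertwiners.
Variables (K : fieldType) (n d : nat) (M : d.-tuple 'M[K]_n).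
Implicit Type XY : 'M[K]_n * 'M[K]_n.

Definition intertwiners : {vspace 'M[K]_n * 'M[K]_n} :=
  (\bigcap_(i < d) lker (linfun
     ((mulmxr M`_i \o fst) \- (mulmx M`_i \o snd) :
        'M[K]_n * 'M[K]_n -> 'M[K]_n)))%VS.

Definition intertwiners_from (k : nat) : {vspace 'M[K]_n * 'M[K]_n} :=
  (intertwiners :&: \bigcap_(i < k) lker (linfun
     (mulmxr M`_i \o fst : 'M[K]_n * 'M[K]_n -> 'M[K]_n)))%VS.

Lemma memv_bigcap m (U : 'I_m -> {vspace 'M[K]_n * 'M[K]_n}) XY :
  reflect (forall i, XY \in U i) (XY \in (\bigcap_(i < m) U i)%VS).
Proof.
rewrite memvE; apply: (iffP subv_bigcapP) => h i; first by rewrite memvE h.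
by move=> _; rewrite -memvE h.
Qed.

Lemma intertwinersP XY :
  reflect (forall i, (i < d)%N -> XY.1 *m M`_i = M`_i *m XY.2)
    (XY \in intertwiners).
Proof.
apply: (iffP (memv_bigcap _ _)) => [h i id|h i].
  by have := h (Ordinal id); rewrite memv_ker lfunE /= subr_eq0 => /eqP.
by rewrite memv_ker lfunE /= subr_eq0 h.
Qed.

Lemma intertwiners_fromP k XY :
  reflect (XY \in intertwiners /\ forall i, (i < k)%N -> XY.1 *m M`_i = 0)
    (XY \in intertwiners_from k).
Proof.
rewrite memv_cap; apply: (iffP andP) => -[XYA h]; split=> //.
  move=> i ik; have /memv_bigcap/(_ (Ordinal ik)) := h.
  by rewrite memv_ker lfunE /= => /eqP.
by apply/memv_bigcap => i; rewrite memv_ker lfunE /= h.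
Qed.

Definition row_span k : 'M[K]_n := (\sum_(i < k) M`_i)%MS.
Definition col_span k : 'M[K]_n := (\sum_(i < k) (M`_i)^T)%MS.

Lemma row_rankE k : row_rank M k = \rank (row_span k).
Proof.
rewrite /row_rank eqmx_col /row_span.
by apply/eqmx_rank/eqmxP/eqmx_sums => i _; apply: genmxE.
Qed.

Lemma col_rankE k : col_rank M k = \rank (col_span k).
Proof.
rewrite /col_rank -mxrank_tr tr_mxrow eqmx_col /col_span.
by apply/eqmx_rank/eqmxP/eqmx_sums => i _; apply: genmxE.
Qed.

(** The form in which profiles enter the dimension counts: the rank of a matrix modulo the span of
    its predecessors. *)
Lemma row_profileE k :
  row_profile M k.+1 = \rank (M`_k *m cokermx (row_span k)).
Proof.
rewrite /row_profile !row_rankE {1}/row_span big_ord_recr /=.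
by rewrite -mxrank_mul_coker addnK.
Qed.

Lemma col_profileE k :
  col_profile M k.+1 = \rank ((M`_k)^T *m cokermx (col_span k)).
Proof.
rewrite /col_profile !col_rankE {1}/col_span big_ord_recr /=.
by rewrite -mxrank_mul_coker addnK.
Qed.

Lemma row_span_mul_eq0 k p (Y : 'M[K]_(n, p)) :
  (forall i, (i < k)%N -> M`_i *m Y = 0) -> row_span k *m Y = 0.
Proof.
move=> h; apply/sub_kermxP/sumsmx_subP => i _; apply/sub_kermxP; exact: h.
Qed.

Lemma col_span_mul_eq0 k p (Y : 'M[K]_(n, p)) :
  (forall i, (i < k)%N -> (M`_i)^T *m Y = 0) -> col_span k *m Y = 0.
Proof.
move=> h; apply/sub_kermxP/sumsmx_subP => i _; apply/sub_kermxP; exact: h.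
Qed.

Lemma intertwiners_from0 : intertwiners_from 0 = intertwiners.
Proof. by rewrite /intertwiners_from big_ord0 capvf. Qed.

Lemma intertwiners_fromS k :
  intertwiners_from k.+1 =
  (intertwiners_from k :&:
   lker (linfun (mulmxr M`_k \o fst : 'M[K]_n * 'M[K]_n -> 'M[K]_n)))%VS.
Proof. by rewrite /intertwiners_from big_ord_recr /= capvA. Qed.

Lemma dim_intertwiners_fromS k : (k < d)%N ->
  (\dim (intertwiners_from k) <=
   row_profile M k.+1 * col_profile M k.+1 + \dim (intertwiners_from k.+1))%N.
Proof.
move=> kd; rewrite intertwiners_fromS.
rewrite -(limg_ker_dim (linfun (mulmxr M`_k \o fst)) (intertwiners_from k)).
rewrite addnC leq_add2r row_profileE col_profileE -(mxrank_tr (_^T *m _)).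
apply: dim_le_rank_mul => _ /memv_imgP[[X Y] /intertwiners_fromP[/intertwinersP XY X0] ->].
rewrite lfunE /=; split.
  (* [Y] is killed by the earlier matrices, so it factors through the cokernel of their row span;
     [X] is treated dually below. *)
  have [Y' eqY] : exists Y', Y = cokermx (row_span k) *m Y'.
    apply/cokermx_factor/row_span_mul_eq0 => i ik.
    by rewrite -[_ *m Y](XY i) ?[_ *m _]X0 // (ltn_trans ik).
  by exists Y'; rewrite -mulmxA -eqY (XY k).
have [X' eqX] : exists X', X^T = cokermx (col_span k) *m X'.
  by apply/cokermx_factor/col_span_mul_eq0 => i ik; rewrite -trmx_mul X0 ?trmx0.
by exists X'^T; apply: trmx_inj; rewrite !trmx_mul !trmxK eqX -mulmxA.
Qed.

Lemma intertwiners_from_full :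
  row_full (col_span d) -> row_full (row_span d) -> intertwiners_from d = 0%VS.
Proof.
move=> /row_fullP[C C1] /row_fullP[N N1]; apply/eqP; rewrite -subv0.
apply/subvP => -[X Y] /intertwiners_fromP[/intertwinersP XY X0].
have Y0 : row_span d *m Y = 0.
  by apply: row_span_mul_eq0 => i id; rewrite -(XY i) ?X0.
have XT0 : col_span d *m X^T = 0.
  by apply: col_span_mul_eq0 => i id; rewrite -trmx_mul X0 ?trmx0.
rewrite memv0; apply/eqP; congr pair; last by rewrite -[LHS]mul1mx -N1 -mulmxA Y0 mulmx0.
by apply: trmx_inj; rewrite trmx0 -[LHS]mul1mx -C1 -mulmxA XT0 mulmx0.
Qed.

Lemma dim_intertwiners_from_le k :
    row_full (col_span d) -> row_full (row_span d) -> (k <= d)%N ->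
  (\dim (intertwiners_from k) <=
   \sum_(k.+1 <= i < d.+1) row_profile M i * col_profile M i)%N.
Proof.
move=> Cd Nd; move: {2}(d - k)%N (erefl (d - k)%N) => e.
elim: e k => [|e IHe] k dk kd.
  have -> : k = d by lia.
  by rewrite intertwiners_from_full // dimv0.
rewrite big_ltn ?ltnS; last by lia.
apply: leq_trans (dim_intertwiners_fromS _) _; first by lia.
by rewrite leq_add2l IHe //; lia.
Qed.

Lemma mem_nth_span i : M`_i \in <<M>>%VS.
Proof.
have [ilt|ige] := ltnP i (size M); first by rewrite memv_span ?mem_nth.
by rewrite nth_default ?mem0v.
Qed.

End Intertwiners.

(** [dim_le_parabolic] replaces the first step of the filtration; the later steps are bounded by
    [dim_intertwiners_from_le]. *)
Lemma dim_intertwiners_le (K : numFieldType) n d (M : d.-tuple 'M[K]_n) q :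
    row_full (col_span M d) -> row_full (row_span M d) -> (0 < d)%N ->
    is_max_rank_span M q -> row_profile M 1 = q ->
  let r := row_profile M 2 in
  (r <= q /\ \dim (intertwiners M) + r * (q - r) <=
   row_profile M 1 * row_profile M 1 +
   \sum_(2 <= i < d.+1) row_profile M i * col_profile M i)%N.
Proof.
move=> Cd Nd d0 [_ maxq] r1 r.
have rM0 : \rank M`_0 = q.
  rewrite -r1 /row_profile row_rankE /row_span big_ord1 /= row_rankE /row_span.
  by rewrite big_ord0 mxrank0 subn0.
have rE : r = \rank (M`_1 *m cokermx M`_0).
  by rewrite /r row_profileE /row_span big_ord1.
have kc : kermx M`_0 *m M`_1 *m cokermx M`_0 = 0.
  apply: ker_coker_max_rank => t; rewrite rM0; apply: maxq.
  by rewrite rpredD ?rpredZ ?mem_nth_span.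
have AS := intertwiners_fromS M 0.
pose f := linfun (mulmxr M`_0 \o fst : 'M[K]_n * 'M[K]_n -> 'M[K]_n).
have [|le_r le_dim] := dim_le_parabolic kc (V := (f @: intertwiners M)%VS).
  move=> _ /memv_imgP[[X Y] /intertwinersP XY ->]; exists X, Y.
  rewrite lfunE /= -XY //; split=> //.
  have [d1|d1] := ltnP 1 d; first exact: XY.
  by rewrite nth_default ?size_tuple // mulmx0 mul0mx.
rewrite r1 -{2}rM0 rE; rewrite rM0 in le_r le_dim; split=> //.
rewrite -(limg_ker_dim f) -{1}intertwiners_from0 -AS rM0 -addnA addnC.
by rewrite leq_add // dim_intertwiners_from_le.
Qed.

(** * Parametrization of the stabilizer by intertwiners *)

Definition linear_mx (K : fieldType) n m (B : 'I_m -> 'M[K]_n) : 'M[mpoly m K]_n :=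
  \matrix_(i, j) \sum_l B l i j *: mpolyX K (mnm1 l).

Lemma map_linear_mx (K : fieldType) n m (B : 'I_m -> 'M[K]_n) (t : 'I_m -> K) :
  map_mx (meval t) (linear_mx B) = \sum_l t l *: B l.
Proof.
apply/matrixP => i j; rewrite !mxE rmorph_sum summxE; apply: eq_bigr => l _.
by rewrite /= mevalZ mevalXU !mxE mulrC.
Qed.

Lemma stabilizer_parametrized (K : fieldType) n d (M : d.-tuple 'M[K]_n) :
  exists (delta : mpoly (\dim (intertwiners M)) K) h,
    forall x, stabilizer M x -> exists t, parametrizes delta h t x.
Proof.
pose b l := (vbasis (intertwiners M))`_l; set m := \dim _ in b *.
pose S := linear_mx (fun l : 'I_m => (b l).2).
(* Since [S] stands for the inverse of [Q^T], [Q] is [(\adj S)^T] divided by [\det S]; [P] is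
   multiplied by [\det S] to share this denominator. *)
pose H := row_mx (mxvec (\det S *: linear_mx (fun l : 'I_m => (b l).1)))
                 (mxvec (\adj S)^T).
exists (\det S), (H 0) => _ [[P Q] /= [uP uQ PQM] <-].
pose v := (P, invmx Q^T).
have uQT : Q^T \in unitmx by rewrite unitmx_tr.
have vA : v \in intertwiners M.
  apply/intertwinersP => i id /=; have := PQM (Ordinal id).
  rewrite (tnth_nth 0) /= => {2}<-.
  by rewrite mulmxK.
pose t l := coord (vbasis (intertwiners M)) l v; exists t.
have v1 : P = \sum_l t l *: (b l).1.
  by rewrite -[LHS]/(v.1) {1}(coord_vbasis vA) (raddf_sum fst).
have v2 : invmx Q^T = \sum_l t l *: (b l).2.
  by rewrite -[LHS]/(v.2) {1}(coord_vbasis vA) (raddf_sum snd).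
have tS : map_mx (meval t) S = invmx Q^T by rewrite map_linear_mx v2.
have tdet : meval t (\det S) = \det (invmx Q^T) by rewrite -tS det_map_mx.
split; first by rewrite tdet -unitfE -unitmxE unitmx_inv.
suff tH : map_mx (meval t) H = meval t (\det S) *: row_mx (mxvec P) (mxvec Q).
  by move=> i; have /rowP/(_ i) := tH; rewrite !mxE.
rewrite map_row_mx scale_row_mx !map_mxvec map_mxZ map_linear_mx -map_trmx map_mx_adj.
rewrite tS /= !tdet -!linearZ -v1; congr (row_mx _ (mxvec _)).
apply: trmx_inj; rewrite trmxK linearZ /= -[LHS]mul1mx -(mulmxV uQT) -mulmxA.
by rewrite mul_mx_adj mul_mx_scalar.
Qed.

Theorem theorem1p11 (R : realType) (n d : nat) (M : d.-tuple 'M[R[i]]_n)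
    (q : nat)
    (Hcol : ((\sum_(i < d) (tnth M i)^T)%MS == (1%:M : 'M[R[i]]_n))%MS)
    (Hrow : ((\sum_(i < d) tnth M i)%MS == (1%:M : 'M[R[i]]_n))%MS)
    (Hq : is_max_rank_span M q)
    (Hqn : (q < n)%N)
    (Hr : nonincreasing_profile d (row_profile M))
    (Hc : nonincreasing_profile d (col_profile M))
    (Hr1 : row_profile M 1 = q)
    (Hc1 : col_profile M 1 = q) :
  (zariski_dim R (stabilizer M) <=
     ((\sum_(1 <= i < d.+1) (row_profile M i)%:R * (col_profile M i)%:R
       - (row_profile M 2)%:R * (q%:R - (row_profile M 2)%:R) : R)%:E))%E.
Proof.
have Cd : row_full (col_span M d).
  rewrite -sub1mx /col_span; case/andP: Hcol => _.
  by under eq_bigr => i _ do rewrite (tnth_nth 0).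
have Rd : row_full (row_span M d).
  rewrite -sub1mx /row_span; case/andP: Hrow => _.
  by under eq_bigr => i _ do rewrite (tnth_nth 0).
have d0 : (0 < d)%N.
  (* For [d = 0] the row span is zero, but [q < n] forces [n] to be positive. *)
  rewrite lt0n; apply: contraTneq Rd => d0; rewrite -col_leq_rank -ltnNge.
  rewrite /row_span big1 ?mxrank0 ?(leq_ltn_trans _ Hqn) // => -[i lti] _.
  by have := lti; rewrite [X in (_ < X)%N]d0.
have [delta [h param]] := stabilizer_parametrized M.
apply: le_trans (zariski_dim_le R param) _.
have [le_r le_dim] := dim_intertwiners_le Cd Rd d0 Hq Hr1.
(* By [le_r] the real difference is the natural one, which reduces the claim to [le_dim]. *)
rewrite lee_fin lerBrDr -natrB // -natrM -natrD.
under eq_bigr => i _ do rewrite -natrM.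
by rewrite -natr_sum ler_nat big_ltn ?ltnS // Hc1 -{2}Hr1.
Qed.
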